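(* Let $W$ be a type-II matrix whose diagonal entries all equal $c$ and whose minimal polynomial is quadratic. If $W-cI$ is Hermitian, then $W-cI$ is a scalar multiple of a generalized conference matrix.
   Context: For a matrix $W$ with all entries non-zero, $W^{(-)}$ denotes its entrywise inverse; an $n\times n$ such matrix is type-II if $W(W^{(-)})^T=nI$. An $n\times n$ matrix $C$ is a generalized conference matrix if $C$ is Hermitian, $C_{i,i}=0$ for all $i$, $|C_{i,j}|=1$ for $i\neq j$, and the minimal polynomial of $C$ is quadratic. *)

(* Defs.v *)
From HB Require Import structures.
From mathcomp Require Import all_boot all_order all_algebra.
From mathcomp Require Export sesquilinear mxpoly.
From mathcomp Require Export complex reals.
Set Implicit Arguments.
Unset Strict Implicit.
Unset Printing Implicit Defensive.
Import Order.TTheory GRing.Theory Num.Theory.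
Local Open Scope ring_scope.

Definition entrywise_inv (F : fieldType) (m n : nat) (W : 'M[F]_(m, n)) :
  'M[F]_(m, n) := map_mx (fun x => x^-1) W.

Definition type_II (F : fieldType) (n : nat) (W : 'M[F]_n) : Prop :=
  (forall i j, W i j != 0) /\ W *m (entrywise_inv W)^T = n%:R%:M.

(* [size p = 3] says that p has degree exactly 2. [mxminpoly] is only defined
   for matrices of positive order, whence the [n.+1]. *)
Definition quadratic_minpoly (F : fieldType) (n : nat) (A : 'M[F]_n.+1) : Prop :=
  size (mxminpoly A) = 3%N.

Definition generalized_conference (C : numClosedFieldType) (n : nat)
    (A : 'M[C]_n.+1) : Prop :=
  [/\ A \is hermsymmx,
      forall i, A i i = 0,
      forall i j, i != j -> `|A i j| = 1
    & quadratic_minpoly A].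

(* Main.v *)
Require Import Defs.
From mathcomp Require Import all_boot all_order all_algebra.
From mathcomp Require Import sesquilinear mxpoly complex reals.
Set Implicit Arguments.
Unset Strict Implicit.
Unset Printing Implicit Defensive.
Import Order.TTheory GRing.Theory Num.Theory.
Local Open Scope ring_scope.
Local Open Scope complex_scope.

(** Write the minimal polynomial of [W] as [X^2 + p1 X + p0] and multiply
    [W^2 + p1 W + p0 I = 0] by the transpose [V] of the entrywise inverse of
    [W]: as [W V = N I], this gives [N W + N p1 I + p0 V = 0], whose
    off-diagonal entries say that [W i j * W j i = - p0 / N] does not depend on
    [i != j]. When [W - c I] is Hermitian, this product is [|W i j|^2], so all
    off-diagonal entries have the same modulus [alpha], and
    [alpha^-1 (W - c I)] has entries of modulus 1. An invertible affine
    substitution does not change the degree of the minimal polynomial. *)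

Lemma horner_mx_comp (R : comNzRingType) (n : nat) (A : 'M[R]_n.+1)
    (p q : {poly R}) :
  horner_mx A (p \Po q) = horner_mx (horner_mx A q) p.
Proof.
elim/poly_ind: p => [|p d IHp]; first by rewrite comp_poly0 !rmorph0.
rewrite comp_polyD comp_polyM comp_polyX comp_polyC !rmorphD !rmorphM /= IHp.
by rewrite !horner_mx_X !horner_mx_C.
Qed.

(** Composing the minimal polynomial of [u *: B + v%:M] with [u X + v] gives a polynomial of the
    same degree that annihilates [B]. This bounds one degree by the other; the inverse substitution
    gives the converse. *)
Lemma size_mxminpoly_affine (F : fieldType) (n : nat) (A : 'M[F]_n.+1)
    (a b : F) :
  a != 0 -> size (mxminpoly (a *: A + b%:M)) = size (mxminpoly A).
Proof.
have le_size (B D : 'M[F]_n.+1) (u v : F) : u != 0 -> D = u *: B + v%:M ->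
    (size (mxminpoly B) <= size (mxminpoly D))%N.
  move=> u0 defD; set q := u *: 'X + v%:P.
  have szq : size q = 2 by rewrite /q size_polyDl size_scale ?size_polyX //
    (leq_ltn_trans (size_polyC_leq1 _)).
  rewrite -(size_comp_poly2 (mxminpoly D) szq) dvdp_leq //.
    by rewrite -size_poly_eq0 size_comp_poly2 // size_poly_eq0 monic_neq0
      ?mxminpoly_monic.
  apply: mxminpoly_min; rewrite horner_mx_comp.
  have -> : horner_mx B q = D.
    rewrite defD /q -mul_polyC rmorphD rmorphM /= horner_mx_X !horner_mx_C.
    by rewrite -mul_scalar_mx.
  exact: mx_root_minpoly.
move=> a0; apply/eqP; rewrite eqn_leq; apply/andP; split.
  apply: (le_size _ _ a^-1 (- (a^-1 * b))); first by rewrite invr_eq0.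
  rewrite scalerDr scalerA mulVf // scale1r scale_scalar_mx -addrA -raddfD /=.
  by rewrite subrr raddf0 addr0.
exact: (le_size _ _ a b).
Qed.

Lemma monic_quadraticE (R : nzRingType) (p : {poly R}) :
  p \is monic -> size p = 3%N -> p = 'X * 'X + (p`_1)%:P * 'X + (p`_0)%:P.
Proof.
move=> /monicP p_monic szp.
have p2 : p`_2 = 1 by rewrite -p_monic /lead_coef szp.
apply/polyP => k; rewrite !coefD coefCM -expr2 coefXn coefX coefC.
case: k => [|[|[|k]]] /=; rewrite ?mulr0 ?mulr1 ?addr0 ?add0r ?p2 //.
by rewrite nth_default // szp.
Qed.

Lemma type_II_quadratic_offdiag (F : numFieldType) (n : nat)
    (W : 'M[F]_n.+1) :
  type_II W -> quadratic_minpoly W ->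
  exists m : F, forall i j, i != j -> W i j * W j i = m.
Proof.
move=> [Wn0 WV] Wquad; set V := (entrywise_inv W)^T in WV.
have := mx_root_minpoly W.
rewrite (monic_quadraticE (mxminpoly_monic W) Wquad).
set p0 := (mxminpoly W)`_0; set p1 := (mxminpoly W)`_1.
rewrite !rmorphD !rmorphM /= horner_mx_X !horner_mx_C -!mulmxE.
move=> /(congr1 (mulmx^~ V)) /=.
rewrite !mulmxDl mul0mx -!mulmxA WV mul_mx_scalar.
rewrite !mul_scalar_mx scale_scalar_mx => eqW.
exists (- p0 / n.+1%:R) => i j nij.
(* Because of the transpose, [V i j] is the inverse of [W j i]: clearing it pairs the opposite
   entries. *)
move/matrixP/(_ i j): eqW; rewrite !mxE (negPf nij) mulr0n addr0 => eqij.
have N0 : n.+1%:R != 0 :> F by rewrite pnatr_eq0.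
apply: (mulfI N0); rewrite mulrA [RHS]mulrCA mulfV // mulr1.
move/eqP: eqij; rewrite addr_eq0 => /eqP ->.
by rewrite mulNr mulfVK.
Qed.

Lemma hermsymmxP (C : numClosedFieldType) (n : nat) (A : 'M[C]_n) :
  reflect (forall i j, A i j = ((A j i)^*)%R) (A \is hermsymmx).
Proof.
apply: (iffP (is_hermitianmxP _ _ _)) => [AE i j | AE].
  by rewrite [in LHS]AE expr0 scale1r !mxE.
by apply/matrixP => i j; rewrite expr0 scale1r !mxE -AE.
Qed.

(** The minimal polynomial divides the characteristic one, of degree [n.+1]. So an off-diagonal
    entry exists. *)
Lemma quadratic_minpoly_order_gt1 (F : fieldType) (n : nat) (A : 'M[F]_n.+1) :
  quadratic_minpoly A -> (0 < n)%N.
Proof.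
move=> Aquad; rewrite -2!ltnS -Aquad -(size_char_poly A) dvdp_leq //.
  by rewrite monic_neq0 ?char_poly_monic.
exact: mxminpoly_dvd_char.
Qed.

Theorem theorem7p4 (R : realType) (n : nat) (W : 'M[R[i]]_n.+1) (c : R[i])
    (W_typeII : type_II W)
    (W_diag : forall i, W i i = c)
    (W_quad : quadratic_minpoly W)
    (W_herm : W - c%:M \is hermsymmx) :
  exists (alpha : R[i]) (A : 'M[R[i]]_n.+1),
    generalized_conference A /\ W - c%:M = alpha *: A.
Proof.
have [m Wm] := type_II_quadratic_offdiag W_typeII W_quad.
have [Wn0 _] := W_typeII; have Wh := hermsymmxP _ W_herm.
have normW i j : i != j -> `|W i j| ^+ 2 = m.
  move=> nij; rewrite -(Wm i j nij) normCK; have := Wh j i.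
  by rewrite !mxE eq_sym (negPf nij) !mulr0n !subr0 => ->.
have n0 := quadratic_minpoly_order_gt1 W_quad.
have n01 : ord0 != ord_max :> 'I_n.+1 by rewrite -val_eqE /= neq_ltn n0.
(* Any off-diagonal entry would do, since [normW] gives them all the same squared modulus. *)
pose alpha : R[i] := `|W ord0 ord_max|.
have a0 : alpha != 0 by rewrite normr_eq0.
exists alpha, (alpha^-1 *: (W - c%:M)); split; last first.
  by rewrite scalerA mulfV // scale1r.
split.
(* Being a modulus, [alpha] is its own conjugate, so scaling by its inverse keeps the matrix
   Hermitian. *)
- apply/hermsymmxP => i j; rewrite mxE Wh [in RHS]mxE rmorphM; congr (_ * _).
  by rewrite fmorphV /= conj_normC.
- by move=> i; rewrite !mxE eqxx W_diag subrr mulr0.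
- move=> i j nij; rewrite !mxE (negPf nij) subr0 normrM normfV normr_id.
  suff -> : `|W i j| = alpha by rewrite mulVf.
  by apply/eqP; rewrite -(@eqrXn2 _ 2%N) ?normr_ge0 // !normW.
rewrite /quadratic_minpoly scalerBr scale_scalar_mx -raddfN /=.
by rewrite size_mxminpoly_affine // invr_eq0.
Qed.
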